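(* Let $q$ be a prime power and let $k\ge 4$ be an even integer. Then $$\begin{aligned}A_q(6k,2k;2k)\ge{}& 1+\left(q^{2k}+1\right)\cdot\left(q^{2k(k+1)} + a(q,2k,2k,k,k) + q^{k(k/2+2)} + 2q^k\right)\\ &+\left(q^{2k(k+1)} + a(q,2k,2k,k,k) + q^{k(k/2+2)} + 2q^k-q^{2k}\right)\cdot q^{2k(k+1)}.\end{aligned}$$
   Context: For a prime power $q$, the subspace distance between subspaces $U,U'$ of $\mathbb{F}_q^n$ is $d(U,U')=\dim(U+U')-\dim(U\cap U')$. $A_q(n,d;k)$ denotes the maximum cardinality of a set of $k$-dimensional subspaces of $\mathbb{F}_q^n$ any two distinct elements of which have subspace distance at least $d$ (a set with at most one element satisfies this vacuously). Write $\left[\begin{smallmatrix} n \\ k \end{smallmatrix}\right]_q=\prod_{i=0}^{k-1}\frac{q^{n-i}-1}{q^{k-i}-1}$. For $1\le d_r\le r\le\min\{m,n\}$ set $$a(q,m,n,d_r,r)=\left[\begin{smallmatrix} \min\{n,m\} \\ r \end{smallmatrix}\right]_q\sum_{s=0}^{r-d_r}(-1)^s q^{\binom{s}{2}}\left[\begin{smallmatrix} r \\ s \end{smallmatrix}\right]_q\left(q^{\max\{n,m\}(r-d_r-s+1)}-1\right),$$ which is the number of rank-$r$ elements of any additive subset of $\mathbb{F}_q^{m\times n}$ of size $q^{\max\{m,n\}(\min\{m,n\}-d_r+1)}$ in which distinct matrices $M,M'$ satisfy $\operatorname{rk}(M-M')\ge d_r$. *)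

(* Defs.v *)
From HB Require Import structures.
From mathcomp Require Import all_boot all_order all_algebra.

Set Implicit Arguments.
Unset Strict Implicit.
Unset Printing Implicit Defensive.

Import Order.TTheory GRing.Theory Num.Theory VectorInternalTheory.
Local Open Scope ring_scope.

(* {vspace vT} is a subtype of square matrices, hence finite over a finite
   field; the library only declares its choiceType structure. *)
HB.instance Definition _ (F : finFieldType) (vT : vectType F) :=
  [Countable of {vspace vT} by <:].
HB.instance Definition _ (F : finFieldType) (vT : vectType F) :=
  [Finite of {vspace vT} by <:].

(* The natural-number subtraction is exact since U :&: V <= U + V. *)
Definition subspace_dist (F : fieldType) (vT : vectType F)
    (U V : {vspace vT}) : nat :=
  (\dim (U + V) - \dim (U :&: V))%N.

Definition constant_dim_code (F : finFieldType) (n d k : nat)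
    (C : {set {vspace 'rV[F]_n}}) : bool :=
  [forall U in C, \dim U == k] &&
  [forall U in C, forall V in C, (U != V) ==> (d <= subspace_dist U V)%N].

(* A_q(n, d; k), where q is the cardinality of F. *)
Definition max_code_size (F : finFieldType) (n d k : nat) : nat :=
  \max_(C : {set {vspace 'rV[F]_n}} | constant_dim_code d k C) #|C|.

(* The quotients are taken in rat, since the single factors need not be
   integers. For n < k the factor i = n makes the product 0. *)
Definition gauss_binom (q n k : nat) : rat :=
  \prod_(i < k) (((q%:R ^+ (n - i)) - 1) / ((q%:R ^+ (k - i)) - 1)).

(* The natural-number subtractions are exact for dr <= r. *)
Definition rank_count (q m n dr r : nat) : rat :=
  gauss_binom q (minn n m) r *
  \sum_(s < (r - dr).+1)
     (-1) ^+ s * q%:R ^+ 'C(s, 2) * gauss_binom q r s *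
     (q%:R ^+ (maxn n m * (r - dr - s + 1)) - 1).

(* Main.v *)
Require Import Defs.
From HB Require Import structures.
From mathcomp Require Import all_boot all_order all_algebra.
From mathcomp Require Import all_fingroup all_field.
From mathcomp Require Import zify ring.

Import Order.TTheory GRing.Theory Num.Theory.
Local Open Scope ring_scope.

Set Implicit Arguments.
Unset Strict Implicit.
Unset Printing Implicit Defensive.

(** The bound comes from an explicit code. Write [q] for the cardinality of [F]
    and [Q = q ^ (2 * k)], and let [L] be the extension of [F] of degree
    [2 * k]. A codeword is then a [2k]-dimensional subspace of [L * L * L], and
    two codewords may meet in dimension at most [k].

    The maps [x |-> a x + sum_(i < k) c_i x^(q^(i+1))] of [L] form an additive
    set of [Q ^ (k + 1)] maps. A nonzero one has a kernel of dimension at most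
    [k], since it is a polynomial function of degree at most [q ^ k]
    ([dim_lker_linearized]); and if all [c_i] vanish it is injective.

    A first code lives in [L * L] ([base_codeP]) and consists of
    - the graphs [(x, f x)] of all these maps [f];
    - the transposed graphs [(g y, y)] of those [g] that are zero or of rank
      [k]; such a subspace meets a graph inside the image of [g];
    - products [A * B] of [k]-dimensional subspaces of [L]; these meet the
      previous ones inside [A] or [B]. Two of them are compatible when
      [\dim (A :&: A') + \dim (B :&: B') <= k]. Identify [L] with [K * K] for
      an extension [K] of degree [k], and take [A] and [B] to be graphs of
      linearized polynomials with [k / 2] higher coefficients. Two such graphs
      meet in dimension at most [k / 2], and trivially when only the
      coefficient of [x] differs, so that [A] and [B] with the same higher
      coefficients give [q ^ (k * (k / 2 + 2))] pairs. The subspace [0 * K] is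
      disjoint from all graphs and yields [2 * q ^ k] pairs more
      ([pair_codeP]).
    Counting the pairs of a map of rank [k] and a basis of its kernel
    ([min_rank_count]) shows that there are at least
    [rank_count q (2 * k) (2 * k) k k] maps of rank [k]. This code
    contains the spread that is formed by [0 * L] and by the graphs of the maps
    [a x].

    The final code ([linked_codeP]) joins three kinds of subspaces of
    [(L * L) * L]. One is [S = 0 * L]. Each of the [Q + 1] spread elements [E]
    spans with [S] a [4k]-dimensional space that carries a copy of the first
    code in which [S] plays the role of the spread element [0 * L]; two of
    these [4k]-dimensional spaces meet in [S] only, and a codeword other than
    [S] meets [S] in dimension at most [k]. Finally, each codeword of [L * L]
    outside the spread is isomorphic to [L], hence is the domain of
    [Q ^ (k + 1)] maps into [L], whose graphs are added; their projections to
    [L * L] meet the elements of the spread in dimension at most [k]. *)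

(** * Extensions of a finite field *)

Lemma natr_card_finField (F : finFieldType) : #|F|%:R = 0 :> F.
Proof.
have [p pr_p pcharFp] := finPcharP F.
move: (finNzRing_gt1 F); rewrite (card_pprimeChar pcharFp).
by move: (logn _ _) => [|n _] //; rewrite natrX (pcharf0 pcharFp) expr0n.
Qed.

(** The extension is the splitting field of ['X^(q ^ m) - 'X], whose roots are
    pairwise distinct and are the elements fixed by the [m]-th power of the
    Frobenius automorphism. *)
Lemma fieldExt_dim_exists (F : finFieldType) (m : nat) : (0 < m)%N ->
  exists L : fieldExtType F, \dim {:L} = m.
Proof.
move=> m_gt0; set q := #|F|; have q_gt1 : (1 < q)%N := finNzRing_gt1 F.
set M := (q ^ m)%N.
have M_gt1 : (1 < M)%N by rewrite -(exp1n m) ltn_exp2r.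
have M_gt0 := ltnW M_gt1; have M1_gt0 : (M.-1 > 0)%N by rewrite -ltnS prednK.
pose P (R : nzRingType) : {poly R} := 'X^M - 'X.
have DP (R : nzRingType) : P R = ('X^(M.-1) - 1) * ('X - 0).
  by rewrite /P subr0 mulrBl mul1r -exprSr prednK.
have /FinSplittingFieldFor[/= L splitLP] : P F != 0.
  by rewrite DP monic_neq0 ?rpredM ?monicXsubC ?monicXnsubC.
rewrite [map_poly _ _]rmorphB /= rmorphXn /= map_polyX -/(P L) in splitLP.
have charL : M%:R = 0 :> L.
  have := rmorph_nat (in_alg L) #|F|; rewrite natr_card_finField rmorph0.
  by move=> h; rewrite /M natrX /q -h expr0n eqn0Ngt m_gt0.
have [/= a _ Da] := finField_galois_generator (sub1v {:L}%AS).
pose Em := fixedSpace (a ^+ m)%g; rewrite dimv1 expn1 in Da.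
have{splitLP} [zs DPL defL] := splitLP.
have Uzs : uniq zs.
  rewrite -separable_prod_XsubC -(eqp_separable DPL) DP separable_root andbC.
  rewrite /root !hornerE subr_eq0 eq_sym expr0n gtn_eqF ?oner_eq0 //=.
  rewrite cyclotomic.separable_Xn_sub_1 // -subn1 natrB // subr_eq0.
  by rewrite charL eq_sym oner_eq0.
exists L; apply/eqP; rewrite -(eqn_exp2l _ _ q_gt1) -/M.
pose Lm := FinFieldExtType L.
have <- : #|Lm| = (q ^ \dim {:L})%N.
  by rewrite -(@card_vspace F Lm) (@card_vspacef F Lm).
suffices /eq_card-> : Lm =i zs.
  apply/eqP/succn_inj; rewrite (card_uniqP _) //= -(size_prod_XsubC _ id).
  by rewrite -(eqp_size DPL) size_polyDl size_polyXn // size_polyN size_polyX.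
have in_zs : zs =i Em.
  move=> z; rewrite -root_prod_XsubC -(eqp_root DPL) (sameP fixedSpaceP eqP).
  rewrite /root !hornerE subr_eq0 /= /M; congr (_ == z).
  elim: (m) => [|i IHi]; first by rewrite gal_id.
  by rewrite expgSr expnSr exprM IHi galM ?Da ?memvf.
suffices defEm : Em = {:L}%VS by move=> z; rewrite in_zs defEm memvf.
apply/eqP; rewrite eqEsubv subvf -defL -[Em]subfield_closed agenvS //.
by rewrite subv_add sub1v; apply/span_subvP=> z; rewrite in_zs.
Qed.

(** * Linear maps into and out of products *)

Section PairLfun.

Variables (F : fieldType) (U V W : vectType F).

Section Def.
Variables (f : 'Hom(U, V)) (g : 'Hom(U, W)).
Definition pair_fun (x : U) : V * W := (f x, g x).
Fact pair_fun_is_linear : linear pair_fun.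
Proof. by move=> a x y; rewrite /pair_fun !linearP. Qed.
HB.instance Definition _ := GRing.isLinear.Build F U (V * W)%type _ pair_fun
  pair_fun_is_linear.
Definition pair_lfun : 'Hom(U, (V * W)%type) := linfun pair_fun.
Lemma pair_lfunE x : pair_lfun x = (f x, g x).
Proof. by rewrite lfunE. Qed.
End Def.

Definition fst_lfun : 'Hom((V * W)%type, V) := linfun fst.
Definition snd_lfun : 'Hom((V * W)%type, W) := linfun snd.
Lemma fst_lfunE x : fst_lfun x = x.1. Proof. by rewrite lfunE. Qed.
Lemma snd_lfunE x : snd_lfun x = x.2. Proof. by rewrite lfunE. Qed.

End PairLfun.

(** * Dimension bounds through maps injective on a subspace *)

Section DimBounds.

Variables (F : fieldType) (U V : vectType F).

Lemma dim_inj_eq (f : 'Hom(U, V)) (X : {vspace U}) :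
  {in X, forall x, f x = 0 -> x = 0} -> \dim (f @: X) = \dim X.
Proof.
move=> inj; apply: limg_dim_eq; apply/eqP; rewrite -subv0.
apply/subvP=> x; rewrite memv_cap memv_ker => /andP[xX /eqP fx0].
by rewrite memv0 (inj x).
Qed.

Lemma dim_inj_le (f : 'Hom(U, V)) (X : {vspace U}) (Y : {vspace V}) :
    {in X, forall x, f x = 0 -> x = 0} -> {in X, forall x, f x \in Y} ->
  (\dim X <= \dim Y)%N.
Proof.
move=> inj sXY; rewrite -(dim_inj_eq inj); apply/dimvS/subvP=> y.
by case/memv_imgP=> x xX ->; apply: sXY.
Qed.

(** A map that is injective on [X :&: Y] and sends it into [Z] bounds its
    dimension by that of [Z]. *)
Lemma cap_dim_le (f : 'Hom(U, V)) (X Y : {vspace U}) (Z : {vspace V}) t :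
    (\dim Z <= t)%N ->
    (forall v, v \in X -> v \in Y -> f v = 0 -> v = 0) ->
    (forall v, v \in X -> v \in Y -> f v \in Z) ->
  (\dim (X :&: Y) <= t)%N.
Proof.
move=> Zt inj sZ; apply: leq_trans Zt; apply: (dim_inj_le (f := f)).
  by move=> v; rewrite memv_cap => /andP[]; apply: inj.
by move=> v; rewrite memv_cap => /andP[]; apply: sZ.
Qed.

Lemma cap_eq0 (X Y : {vspace U}) :
  (forall v, v \in X -> v \in Y -> v = 0) -> \dim (X :&: Y) = 0%N.
Proof.
move=> h; apply/eqP; rewrite dimv_eq0 -subv0; apply/subvP=> v.
by rewrite memv_cap memv0 => /andP[vX vY]; rewrite (h v).
Qed.

(** Subspaces of equal dimension are isomorphic, by a map defined everywhere. *)
Lemma inj_lfun_exists (X : {vspace U}) : \dim X = \dim {:V} ->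
  {h : 'Hom(U, V) | {in X, forall x, h x = 0 -> x = 0}}.
Proof.
move=> dX; have [f fP] := linear_of_free (vbasis X) (vbasis {:V}).
exists (linfun f) => x xX fx0.
have imX : (linfun f @: X = {:V})%VS.
  rewrite -[in LHS](span_basis (vbasisP X)) limg_span.
  rewrite (eq_map (lfunE f)) fP ?(basis_free (vbasisP X)) //.
    exact: span_basis (vbasisP _).
  by rewrite !size_tuple dX.
have := limg_ker_dim (linfun f) X; rewrite imX dX => /(canRL (addnK _)).
rewrite subnn => /eqP; rewrite dimv_eq0 => /eqP kX.
by apply/eqP; rewrite -memv0 -kX memv_cap xX memv_ker fx0 eqxx.
Qed.

End DimBounds.

(** * Indexed constant dimension codes *)

(** A family of [m]-dimensional subspaces that pairwise meet in dimension at
    most [t], so that their pairwise subspace distance is at least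
    [2 * (m - t)]. *)
Definition code_family (F : fieldType) (vT : vectType F) (I : Type)
    (c : I -> {vspace vT}) (m t : nat) :=
  (forall i, \dim (c i) = m) /\
  (forall i j, i <> j -> (\dim (c i :&: c j) <= t)%N).

Lemma code_family_dim (F : fieldType) (vT : vectType F) (I : Type)
    (c : I -> {vspace vT}) m t :
  code_family c m t -> forall i, \dim (c i) = m.
Proof. by case. Qed.

Lemma code_family_cap (F : fieldType) (vT : vectType F) (I : Type)
    (c : I -> {vspace vT}) m t :
  code_family c m t -> forall i j, i <> j -> (\dim (c i :&: c j) <= t)%N.
Proof. by case. Qed.

Lemma code_family_comp (F : fieldType) (vT : vectType F) (I I' : Type)
    (c : I -> {vspace vT}) (g : I' -> I) m t :
  injective g -> code_family c m t -> code_family (c \o g) m t.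
Proof. by move=> gI [dc pc]; split=> [i|i j nij] /=; [|apply: pc => /gI]. Qed.

Lemma code_family_limg (F : fieldType) (U V : vectType F) (I : Type)
    (c : I -> {vspace U}) (f : 'Hom(U, V)) m t :
  injective f -> code_family c m t ->
  code_family (fun i => (f @: c i)%VS) m t.
Proof.
move=> /lker0P f0 [dc pc]; split=> [i|i j nij].
  by rewrite limg_dim_eq ?dc // (eqP f0) capv0.
rewrite -lker0_img_cap // limg_dim_eq ?pc //.
by rewrite (eqP f0) capv0.
Qed.

(** As [t < m], the members of the family are pairwise distinct. *)
Lemma code_family_max (F : finFieldType) (vT : vectType F) (I : finType)
    (c : I -> {vspace vT}) m t d :
    code_family c m t -> (t < m)%N -> (d <= 2 * (m - t))%N ->
  (#|I| <= max_code_size F (\dim {:vT}) d m)%N.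
Proof.
move=> cc tm dmt; set n := \dim {:vT}.
have dn : \dim {:vT} = \dim {:'rV[F]_n}.
  by rewrite [RHS]dimvf [RHS]dim_matrix; apply/esym/mul1n.
have [f f0] := inj_lfun_exists dn.
have fI : injective f.
  move=> x y fxy; apply/eqP; rewrite -subr_eq0; apply/eqP/f0; rewrite ?memvf //.
  by rewrite linearB /= fxy subrr.
pose c' (i : I) := (f @: c i)%VS.
have [dc' pc'] : code_family c' m t := code_family_limg fI cc.
have cI : injective c'.
  move=> i j eqc; apply/eqP; case: (altP (i =P j)) => // /eqP nij.
  by have := pc' i j nij; rewrite eqc capvv dc' leqNgt tm.
rewrite -cardsT -(card_imset _ cI).
apply: (@leq_bigmax_cond _ _ (fun C : {set {vspace _}} => #|C|)).
apply/andP; split.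
  by apply/'forall_implyP=> U /imsetP[i _ ->]; rewrite dc'.
apply/'forall_implyP=> U /imsetP[i _ ->].
apply/'forall_implyP=> V /imsetP[j _ ->]; apply/implyP=> nc.
have nij : i <> j by move=> h; rewrite h eqxx in nc.
rewrite /subspace_dist.
have := dimv_sum_cap (c' i) (c' j); rewrite !dc'; have := pc' i j nij.
move: (\dim (_ + _)) (\dim (_ :&: _)) => a b bt ab.
by lia.
Qed.

(** * Linkage with a code that contains a spread *)

(** Graph of [h] over the subspace [X], for a map [h] defined everywhere. *)
Definition graph_over (F : fieldType) (U V : vectType F) (h : 'Hom(U, V))
    (X : {vspace U}) : {vspace (U * V)%type} :=
  (pair_lfun \1 h @: X)%VS.

Lemma mem_graph_over (F : fieldType) (U V : vectType F) (h : 'Hom(U, V))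
    (X : {vspace U}) (v : (U * V)%type) :
  (v \in graph_over h X) = (v.1 \in X) && (v.2 == h v.1).
Proof.
apply/memv_imgP/andP=> [[x xX ->]|[xX /eqP hv]].
  by rewrite pair_lfunE /= id_lfunE eqxx.
by exists v.1; rewrite // pair_lfunE id_lfunE -hv; case: (v).
Qed.

Lemma dim_graph_over (F : fieldType) (U V : vectType F) (h : 'Hom(U, V))
    (X : {vspace U}) : \dim (graph_over h X) = \dim X.
Proof. by apply: dim_inj_eq => x _; rewrite pair_lfunE id_lfunE => -[]. Qed.

(** The data of the linkage: [c] is a code of [W] whose members [c (inr s)]
    pairwise meet in [0], as in a spread; the map [e s] parametrizes
    [c (inr s)] by [L]; the map [h j] is injective on [c (inl j)]; [f] is a
    rank metric code; and [b] is a code of [L * L] that contains [0 * L]. The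
    index [None] of the spread is only needed to name one of its elements. *)
Section Linkage.

Variables (F : fieldType) (L W : vectType F) (m t : nat).
Variables (J S : eqType) (R K : Type).
Variables (c : J + option S -> {vspace W}) (e : option S -> 'Hom(L, W)).
Variables (h : J -> 'Hom(W, L)) (f : R -> 'End(L)).
Variable b : option K -> {vspace (L * L)%type}.

Hypothesis cC : code_family c m t.
Hypothesis eI : forall s x, e s x = 0 -> x = 0.
Hypothesis eE : forall s, limg (e s) = c (inr s).
Hypothesis eD : forall s s' x y, s <> s' -> e s x = e s' y -> e s x = 0.
Hypothesis hI : forall j, {in c (inl j), forall u, h j u = 0 -> u = 0}.
Hypothesis fC : forall r r', r <> r' -> (\dim (lker (f r - f r')%R) <= t)%N.
Hypothesis bC : code_family b m t.
Hypothesis b0 : forall v, (v \in b None) = (v.1 == 0).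

(* An isomorphism from [L * L] to the space spanned by [c (inr s)] and
   [0 * L]. *)
Let phi (s : option S) : 'Hom((L * L)%type, (W * L)%type) :=
  pair_lfun (e s \o fst_lfun L L) (snd_lfun L L).

Let phiE s v : phi s v = (e s v.1, v.2).
Proof. by rewrite pair_lfunE comp_lfunE fst_lfunE snd_lfunE. Qed.

Let phiI s : injective (phi s).
Proof.
move=> [x y] [x' y']; rewrite !phiE /= => -[/eqP].
by rewrite -subr_eq0 -linearB => /eqP/eI/eqP; rewrite subr_eq0 => /eqP-> ->.
Qed.

(** The subspace [0 * L], the images of [b] in the spaces spanned by it and an
    element of the spread, and the graphs over the other members of [c]. *)
Definition linked_code (i : option (option S * K + J * R)) :
    {vspace (W * L)%type} :=
  match i with
  | None => (phi None @: b None)%VS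
  | Some (inl (s, k)) => (phi s @: b (Some k))%VS
  | Some (inr (j, r)) => graph_over (f r \o h j) (c (inl j))
  end.

Let cap_phi s k k' : k <> k' ->
  (\dim ((phi s @: b k) :&: (phi s @: b k')) <= t)%N.
Proof. exact: (code_family_cap (code_family_limg (@phiI s) bC)). Qed.

Let mem_phi s k v : v \in (phi s @: b k)%VS ->
  exists2 x, v.1 = e s x & (x, v.2) \in b k.
Proof. by case/memv_imgP=> -[x y] xy ->; exists x; rewrite phiE. Qed.

(* All the maps [phi s] send [b None] to the same subspace [0 * L]. *)
Let phi0 s : (phi s @: b None = phi None @: b None)%VS.
Proof.
have sub s1 s2 : (phi s1 @: b None <= phi s2 @: b None)%VS.
  apply/subvP=> _ /memv_imgP[[x y] xb ->]; apply/memv_imgP.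
  exists (x, y) => //; move: xb; rewrite b0 /= => /eqP->.
  by rewrite !phiE !linear0.
by apply/eqP; rewrite eqEsubv !sub.
Qed.

Let phi_graph s k j r :
  (\dim ((phi s @: b k) :&: graph_over (f r \o h j) (c (inl j))) <= t)%N.
Proof.
apply: (cap_dim_le (f := fst_lfun W L) (Z := c (inr s) :&: c (inl j))).
- by apply: (code_family_cap cC).
- move=> v _; rewrite mem_graph_over fst_lfunE => /andP[_ /eqP v2] v1.
  by rewrite [v]surjective_pairing v2 v1 !linear0.
move=> v /mem_phi[x v1 _]; rewrite mem_graph_over fst_lfunE memv_cap.
by case/andP=> -> _; rewrite v1 -eE memv_img ?memvf.
Qed.

Let phi_phi s s' k k' : k <> None -> s <> s' \/ k <> k' ->
  (\dim ((phi s @: b k) :&: (phi s' @: b k')) <= t)%N.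
Proof.
move=> k0; have [<- [|]|/eqP ss' _] := altP (s =P s') => //.
  exact: cap_phi.
(* Spaces attached to distinct spread elements meet in [0 * L]. *)
apply: leq_trans (cap_phi s k0); apply/dimvS/subvP=> v; rewrite !memv_cap.
case/andP=> vk vk'; rewrite vk phi0 /=.
have [[x v1 _] [x' v1' _]] := (mem_phi vk, mem_phi vk').
have v10 : v.1 = 0 by rewrite v1; apply: (eD (y := x') ss'); rewrite -v1.
apply/memv_imgP; exists (0, v.2); first by rewrite b0.
by rewrite phiE linear0 -v10 -surjective_pairing.
Qed.

Let graph_graph j j' r r' : (j, r) <> (j', r') ->
  (\dim (graph_over (f r \o h j) (c (inl j)) :&:
         graph_over (f r' \o h j') (c (inl j'))) <= t)%N.
Proof.
have [<- neq|/eqP jj' _] := altP (j =P j'); last first.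
  apply: (cap_dim_le (f := fst_lfun W L) (Z := c (inl j) :&: c (inl j'))).
  - by apply: (code_family_cap cC) => -[].
  - move=> v _; rewrite mem_graph_over fst_lfunE => /andP[_ /eqP v2] v1.
    by rewrite [v]surjective_pairing v2 v1 !linear0.
  move=> v; rewrite !mem_graph_over fst_lfunE memv_cap.
  by case/andP=> -> _ /andP[-> _].
have rr' : r <> r' by move=> rr'; case: neq; rewrite rr'.
apply: (cap_dim_le (f := (h j \o fst_lfun W L)%VF) (Z := lker (f r - f r'))).
- exact: fC.
- move=> v _; rewrite mem_graph_over !comp_lfunE fst_lfunE => /andP[vc /eqP v2].
  by move=> /(hI vc) v1; rewrite [v]surjective_pairing v2 v1 !linear0.
move=> v; rewrite !mem_graph_over !comp_lfunE fst_lfunE.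
case/andP=> _ /eqP v2 /andP[_ /eqP v2'].
by apply/eqlfunP; rewrite -v2.
Qed.

Lemma linked_codeP : code_family linked_code m t.
Proof.
have phi_dim s k : \dim (phi s @: b k)%VS = m.
  exact: (code_family_dim (code_family_limg (@phiI s) bC)).
split.
  case=> [[[s k]|[j r]]|] /=; rewrite ?phi_dim //.
  by rewrite dim_graph_over (code_family_dim cC).
case=> [[[s k]|[j r]]|] [[[s' k']|[j' r']]|] neq //=.
- apply: phi_phi => //; have [ss'|/eqP] := altP (s =P s'); last by left.
  by right=> -[kk']; case: neq; rewrite ss' kk'.
- by apply: phi_phi => //; right.
- by rewrite capvC.
- by apply: graph_graph => eqjr; case: neq; rewrite eqjr.
- by rewrite capvC.
- by rewrite capvC; apply: phi_phi => //; right.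
Qed.

End Linkage.

(** * Linearized polynomials (Gabidulin codes) *)

Section Linearized.

Variables (F : finFieldType) (L : fieldExtType F).
Local Notation q := #|F|.

Lemma expr_card_linear i (a : F) (x y : L) :
  (a *: x + y) ^+ (q ^ i) = a *: x ^+ (q ^ i) + y ^+ (q ^ i).
Proof.
have [p pr_p pcharFp] := finPcharP F.
have qN : [pchar L].-nat (q ^ i)%N.
  rewrite (card_pprimeChar pcharFp) -expnM pnatX; apply/orP; left.
  by rewrite pnatE // pchar_lalg.
rewrite exprDn_pchar // exprZn; congr (_ *: _ + _).
by elim: i {qN} => [|i IHi]; rewrite ?expr1 // expnSr exprM IHi expf_card.
Qed.

Variable t : nat.
Implicit Types u v : (L * {ffun 'I_t -> L})%type.

(** The map [a x + sum_(i < t) c_i x^(q^(i+1))] attached to [(a, c)]. The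
    coefficient [a] of [x] is kept apart since the maps that share [c] form a
    code of larger distance. *)
Definition linearized_fun u (x : L) : L :=
  u.1 * x + \sum_i u.2 i * x ^+ (q ^ i.+1).

(** The polynomial that [linearized_fun] evaluates. *)
Definition linearized_poly u : {poly L} :=
  u.1 *: 'X + \sum_i u.2 i *: 'X^(q ^ i.+1).

Lemma horner_linearized_poly u x : (linearized_poly u).[x] = linearized_fun u x.
Proof.
rewrite hornerD hornerZ hornerX horner_sum; congr (_ + _).
by apply: eq_bigr => i _; rewrite hornerZ hornerXn.
Qed.

Fact linearized_fun_is_linear u : linear (linearized_fun u).
Proof.
move=> a x y; rewrite /linearized_fun mulrDr scalerDr -scalerAr addrACA.
congr (_ + _); rewrite scaler_sumr -big_split /=; apply: eq_bigr => i _.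
by rewrite expr_card_linear mulrDr scalerAr.
Qed.
HB.instance Definition _ u := GRing.isLinear.Build F L L _ (linearized_fun u)
  (linearized_fun_is_linear u).

Definition linearized u : 'End(L) := linfun (linearized_fun u).

Lemma linearizedE u x : linearized u x = linearized_fun u x.
Proof. exact: lfunE. Qed.

Lemma linearizedB u v : linearized (u - v) = linearized u - linearized v.
Proof.
apply/lfunP=> x; rewrite add_lfunE opp_lfunE !linearizedE /linearized_fun.
rewrite opprD addrACA mulrBl; congr (_ + _); rewrite -sumrB.
by apply: eq_bigr => i _; rewrite !ffunE mulrBl.
Qed.

Lemma linearized_poly_neq0 u : u != 0 -> linearized_poly u != 0.
Proof.
have q_gt1 : (1 < q)%N := finNzRing_gt1 F.
apply: contra_neq => Pu0; have P0 n : (linearized_poly u)`_n = 0.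
  by rewrite Pu0 coef0.
case: u P0 {Pu0} => a c P0; congr (_, _).
  rewrite -(P0 1%N) coefD coefZ coefX mulr1 coef_sum big1 ?addr0 // => i _.
  by rewrite coefZ coefXn -(expn0 q) eqn_exp2l // mulr0.
apply/ffunP=> i; rewrite ffunE -(P0 (q ^ i.+1)%N) coefD coefZ coefX.
rewrite -[X in _ == X](expn0 q) eqn_exp2l // mulr0 add0r coef_sum.
rewrite (bigD1 i) //= coefZ coefXn eqxx mulr1 big1 ?addr0 // => j nij.
by rewrite coefZ coefXn eqn_exp2l // eqSS eq_sym val_eqE (negbTE nij) mulr0.
Qed.

Lemma dim_lker_linearized u : u != 0 -> (\dim (lker (linearized u)) <= t)%N.
Proof.
have q_gt1 : (1 < q)%N := finNzRing_gt1 F.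
move=> /linearized_poly_neq0 Pu0; rewrite -(leq_exp2l _ _ q_gt1).
pose fL := finvect_type L; pose fK : {vspace fL} := lker (linearized u).
rewrite -(card_vspace fK) cardE -ltnS.
have sP : (size (linearized_poly u) <= (q ^ t).+1)%N.
  rewrite (leq_trans (size_polyD _ _)) // geq_max.
  rewrite (leq_trans (size_scale_leq _ _)) /=; last first.
    by rewrite size_polyX ltnS expn_gt0 (ltnW q_gt1).
  apply: (leq_trans (size_sum _ _ _)); apply/bigmax_leqP=> i _.
  by rewrite (leq_trans (size_scale_leq _ _)) // size_polyXn ltnS leq_exp2l.
apply: leq_trans sP; apply: max_poly_roots => //; last exact: enum_uniq.
apply/allP=> x; rewrite mem_enum memv_ker rootE horner_linearized_poly.
by rewrite linearizedE.
Qed.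

Lemma dim_lker_linearizedB u v : u <> v ->
  (\dim (lker (linearized u - linearized v)%R) <= t)%N.
Proof.
move=> /eqP uv; rewrite -linearizedB; apply: dim_lker_linearized.
by rewrite subr_eq0.
Qed.

(** The difference of two maps that differ only in the coefficient of [x] is
    the multiplication by a nonzero scalar, hence injective. *)
Lemma linearized_inj_coset a a' c x : a <> a' ->
  linearized (a, c) x = linearized (a', c) x -> x = 0.
Proof.
rewrite !linearizedE /linearized_fun /= => /eqP aa' /addIr/eqP.
by rewrite -subr_eq0 -mulrBl mulf_eq0 subr_eq0 (negbTE aa') => /eqP.
Qed.

End Linearized.

(** * Counting the maps of minimum rank *)

Lemma card_le_fibers (A B : finType) (f : A -> B) (N : nat) :
  (forall b, #|[pred a | f a == b]| <= N)%N -> (#|A| <= #|B| * N)%N.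
Proof.
move=> fN; rewrite -sum1_card (partition_big f xpredT) //= -sum_nat_const.
by apply: leq_sum => b _; apply: leq_trans (fN b); rewrite -sum1_card.
Qed.

Section FreeTuples.

Variables (F : finFieldType) (vT : vectType F).
Local Notation q := #|F|.
Local Notation V := (finvect_type vT).
Implicit Types U X : {vspace V}.

Lemma card_vspaceD X U : (X <= U)%VS ->
  #|[pred v in U | v \notin X]| = (q ^ \dim U - q ^ \dim X)%N.
Proof.
move=> /subvP sXU; rewrite -!card_vspace -(cardID (mem X) (mem U)).
rewrite [X in (X + _ - _)%N](_ : _ = #|X|); last first.
  apply: eq_card => v; rewrite !inE andbC.
  by case vX: (v \in X); rewrite ?(sXU _ vX).
by rewrite addKn; apply: eq_card => v; rewrite !inE andbC.
Qed.

(** Number of linearly independent [j]-tuples of a subspace. *)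
Lemma card_free_tuples U j :
  #|[pred w : j.-tuple V | free w && all (mem U) w]| =
  (\prod_(i < j) (q ^ \dim U - q ^ i))%N.
Proof.
elim: j => [|j IHj].
  rewrite big_ord0 (eq_card (B := predT)) ?card_tuple ?expn0 // => w.
  by rewrite !inE tuple0 /= nil_free.
rewrite big_ord_recr /= -IHj -[LHS]sum1_card -[X in (X * _)%N]sum1_card.
rewrite (reindex (fun p : j.-tuple V * V => cons_tuple p.2 p.1)) /=; last first.
  exists (fun w => (behead_tuple w, thead w)) => [[w v] _|w _] /=.
    by congr (_, _); apply: val_inj.
  by rewrite [RHS]tuple_eta; apply: val_inj.
rewrite big_distrl /=.
rewrite (eq_bigl (fun p : j.-tuple V * V =>
   (free p.1 && all (mem U) p.1) &&
   ((p.2 \in U) && (p.2 \notin <<p.1>>%VS)))); last first.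
  move=> [w v]; rewrite !inE free_cons /= andbACA andbC.
  by rewrite [(_ \notin _) && _]andbC.
rewrite -(pair_big_dep (fun w : j.-tuple V => free w && all (mem U) w)
  (fun (w : j.-tuple V) v => (v \in U) && (v \notin <<w>>%VS))
  (fun _ _ => 1%N)) /=.
apply: eq_big => [w|w /andP[fw /allP wU]]; first by rewrite !inE.
rewrite mul1n sum1_card card_vspaceD; last by apply/span_subvP.
by move: fw => /eqP ->; rewrite size_tuple.
Qed.

End FreeTuples.

Section MinRankCount.

Variables (F : finFieldType) (L0 : fieldExtType F) (t : nat).
Local Notation q := #|F|.
Local Notation L := (finvect_type L0).
Local Notation n := (\dim {:L0}).
Local Notation coefs := (L * {ffun 'I_t -> L})%type.

Lemma card_finvect_fullv : #|L| = (q ^ n)%N.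
Proof. by rewrite -(card_vspace (fullv : {vspace L})) card_vspacef. Qed.

(** Vanishing on [w] amounts to [t] additive equations in [L] for [t + 1]
    coefficients. *)
Lemma card_linearized_killing (w : t.-tuple L) :
  (q ^ n <= #|[pred u : coefs | all (fun x => linearized u x == 0%R) w]|)%N.
Proof.
pose ev (u : coefs) : {ffun 'I_t -> L} := [ffun i => linearized u (tnth w i)].
pose K := [pred u : coefs | all (fun x => linearized u x == 0) w].
have fibK y : (#|[pred u | ev u == y]| <= #|K|)%N.
  have [u0 /eqP evu0|no] := pickP (fun u => ev u == y); last first.
    by rewrite eq_card0.
  rewrite -(card_imset _ (addIr (- u0))); apply/subset_leq_card/subsetP=> c.
  case/imsetP=> u; rewrite !inE -evu0 => /eqP/ffunP evu ->.
  apply/allP=> _ /tnthP[i ->]; have := evu i; rewrite !ffunE linearizedB => evi.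
  by rewrite add_lfunE opp_lfunE evi subrr.
have := card_le_fibers fibK.
rewrite card_prod card_ffun card_ord mulnC leq_pmul2l; last first.
  by rewrite expn_gt0; apply/orP; left; apply/card_gt0P; exists 0.
by rewrite card_finvect_fullv.
Qed.

(** Double count of the pairs of a nonzero map [u] and an independent
    [t]-tuple [w] in its kernel: every [w] occurs with at least [q ^ n - 1]
    maps, and a map that occurs has a kernel of dimension exactly [t], with
    [w] as a basis. *)
Lemma min_rank_count :
  (\prod_(i < t) (q ^ n - q ^ i) * (q ^ n - 1) <=
   #|[pred u : coefs | \dim (lker (linearized u)) == t]| *
     \prod_(i < t) (q ^ t - q ^ i))%N.
Proof.
pose fL : {vspace L} := fullv.
pose P (w : t.-tuple L) := free w && all (mem fL) w.
pose Q (u : coefs) (w : t.-tuple L) := all (fun x => linearized u x == 0) w.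
pose N := (\sum_(w | P w) \sum_(u : coefs | (u != 0%R) && Q u w) 1)%N.
apply: (@leq_trans N).
  rewrite -(card_free_tuples fL) -sum_nat_const; apply: leq_sum => w _.
  rewrite sum1_card leq_subLR.
  apply: leq_trans (card_linearized_killing w) _.
  rewrite [leqLHS](cardD1 (0 : coefs)); apply: leq_add; first exact: leq_b1.
  by apply: subset_leq_card; apply/subsetP=> u.
rewrite /N (exchange_big_dep (predC1 (0 : coefs))) /=; last first.
  by move=> w u _ /andP[].
rewrite (bigID (fun u : coefs => \dim (lker (linearized u)) == t)) /=.
rewrite [X in (_ + X <= _)%N]big1 ?addn0; last first.
  move=> u /andP[u0 nt]; rewrite big1 // => w.
  case/andP=> /andP[fw _] /andP[_ /allP Qw].
  case/negP: nt; rewrite eqn_leq dim_lker_linearized //=.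
  rewrite -[X in (X <= _)%N](size_tuple w) -(eqP fw).
  by apply/dimvS/span_subvP=> x xw; rewrite memv_ker Qw.
pose M := (\prod_(i < t) (q ^ t - q ^ i))%N.
apply: (@leq_trans (\sum_(u : coefs | (u != 0%R) &&
    (\dim (lker (linearized u)) == t)) M)).
  apply: leq_sum => u /andP[_ /eqP dt].
  pose K : {vspace L} := lker (linearized u).
  have -> : M = (\prod_(i < t) (q ^ \dim K - q ^ i))%N by rewrite dt.
  rewrite -card_free_tuples sum1_card; apply/subset_leq_card/subsetP=> w.
  rewrite !inE => /andP[/andP[-> _] /andP[_ /allP Qw]] /=.
  by apply/allP=> x xw; rewrite /= memv_ker Qw.
rewrite sum_nat_const leq_mul2r; apply/orP; right.
by apply/subset_leq_card/subsetP=> u /andP[].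
Qed.

End MinRankCount.

(** * A code that contains a spread *)

Lemma dim_fullv_prod (F : fieldType) (U V : vectType F) :
  \dim {: (U * V)%type} = (\dim {:U} + \dim {:V})%N.
Proof. by rewrite !dimvf. Qed.

(** The graph of [g] with the two coordinates exchanged. *)
Definition cograph (F : fieldType) (U V : vectType F) (g : 'Hom(V, U)) :
  {vspace (U * V)%type} := limg (pair_lfun g \1).

Lemma mem_cograph (F : fieldType) (U V : vectType F) (g : 'Hom(V, U)) v :
  (v \in cograph g) = (v.1 == g v.2).
Proof.
apply/memv_imgP/eqP=> [[y _ ->]|gv]; first by rewrite pair_lfunE id_lfunE.
by exists v.2; rewrite ?memvf // pair_lfunE id_lfunE -gv; case: (v).
Qed.

Lemma dim_cograph (F : fieldType) (U V : vectType F) (g : 'Hom(V, U)) :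
  \dim (cograph g) = \dim {:V}.
Proof. by apply: dim_inj_eq => x _; rewrite pair_lfunE id_lfunE => -[]. Qed.

(** The product [A * B] as a subspace of [U * V]. *)
Definition prodv (F : fieldType) (U V : vectType F) (A : {vspace U})
    (B : {vspace V}) : {vspace (U * V)%type} :=
  (pair_lfun \1 0 @: A + pair_lfun 0 \1 @: B)%VS.

Lemma mem_prodv (F : fieldType) (U V : vectType F) (A : {vspace U})
    (B : {vspace V}) v :
  (v \in prodv A B) = (v.1 \in A) && (v.2 \in B).
Proof.
apply/memv_addP/andP=> [[_ /memv_imgP[x xA ->] [_ /memv_imgP[y yB ->] ->]]|].
  by rewrite !pair_lfunE !zero_lfunE !id_lfunE /= addr0 add0r.
case=> vA vB; exists (v.1, 0).
  by apply/memv_imgP; exists v.1; rewrite // pair_lfunE zero_lfunE id_lfunE.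
exists (0, v.2).
  by apply/memv_imgP; exists v.2; rewrite // pair_lfunE zero_lfunE id_lfunE.
by rewrite [LHS]surjective_pairing; congr (_, _); rewrite /= ?addr0 ?add0r.
Qed.

Lemma dim_prodv (F : fieldType) (U V : vectType F) (A : {vspace U})
    (B : {vspace V}) : \dim (prodv A B) = (\dim A + \dim B)%N.
Proof.
rewrite dimv_disjoint_sum.
  congr (_ + _)%N; apply: dim_inj_eq => x _.
    by rewrite pair_lfunE id_lfunE => -[].
  by rewrite pair_lfunE id_lfunE => -[].
apply/eqP; rewrite -dimv_eq0; apply/eqP/cap_eq0=> v.
case/memv_imgP=> x _ -> /memv_imgP[y _].
by rewrite !pair_lfunE !zero_lfunE !id_lfunE => -[-> _].
Qed.

Section BaseCode.

Variables (F : finFieldType) (L : fieldExtType F) (t : nat) (P : Type).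
Variables (A B : P -> {vspace L}).
Local Notation n := (\dim {:L}).
Local Notation coefs := (L * {ffun 'I_t -> L})%type.

Hypothesis dimL : n = (t + t)%N.
Hypothesis dimA : forall p, \dim (A p) = t.
Hypothesis dimB : forall p, \dim (B p) = t.
Hypothesis capAB : forall p p', p <> p' ->
  (\dim (A p :&: A p') + \dim (B p :&: B p') <= t)%N.

(** Graphs of all linearized polynomials, transposed graphs of those of rank at
    most [n - t], and products of a family of pairs of subspaces. The zero map
    is among the transposed graphs and yields [0 * L]. *)
Definition base_code
    (i : coefs + {u : coefs | (t <= \dim (lker (linearized u)))%N} + P) :
    {vspace (L * L)%type} :=
  match i with
  | inl (inl u) => graph_over (linearized u) fullv
  | inl (inr g) => cograph (linearized (val g))
  | inr p => prodv (A p) (B p)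
  end.

Let graph_graph (u u' : coefs) : u <> u' ->
  (\dim (graph_over (linearized u) fullv :&:
         graph_over (linearized u') fullv) <= t)%N.
Proof.
move=> uu'; apply: (cap_dim_le (f := fst_lfun L L)).
- exact: dim_lker_linearizedB uu'.
- move=> v _; rewrite mem_graph_over fst_lfunE => /andP[_ /eqP v2] v1.
  by rewrite [v]surjective_pairing v2 v1 linear0.
move=> v; rewrite !mem_graph_over fst_lfunE.
by case/andP=> _ /eqP v2 /andP[_ /eqP v2']; apply/eqlfunP; rewrite -v2.
Qed.

Let cograph_cograph (u u' : coefs) : u <> u' ->
  (\dim (cograph (linearized u) :&: cograph (linearized u')) <= t)%N.
Proof.
move=> uu'; apply: (cap_dim_le (f := snd_lfun L L)).
- exact: dim_lker_linearizedB uu'.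
- move=> v _; rewrite mem_cograph snd_lfunE => /eqP v1 v2.
  by rewrite [v]surjective_pairing v1 v2 linear0.
move=> v; rewrite !mem_cograph snd_lfunE => /eqP v1 /eqP v1'.
by apply/eqlfunP; rewrite -v1.
Qed.

Let graph_cograph (u u' : coefs) : (t <= \dim (lker (linearized u')))%N ->
  (\dim (graph_over (linearized u) fullv :&: cograph (linearized u')) <= t)%N.
Proof.
move=> ku'; apply: (cap_dim_le (f := fst_lfun L L) (Z := limg (linearized u'))).
- have := limg_ker_dim (linearized u') fullv; rewrite capfv dimL.
  by move=> kE; rewrite -(leq_add2l t) -kE leq_add2r.
- move=> v; rewrite mem_graph_over fst_lfunE => /andP[_ /eqP v2] _ v1.
  by rewrite [v]surjective_pairing v2 v1 linear0.
by move=> v _; rewrite mem_cograph fst_lfunE => /eqP->; apply/memv_img/memvf.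
Qed.

Let graph_prodv (u : coefs) p :
  (\dim (graph_over (linearized u) fullv :&: prodv (A p) (B p)) <= t)%N.
Proof.
apply: (cap_dim_le (f := fst_lfun L L) (Z := A p)); first by rewrite dimA.
- move=> v; rewrite mem_graph_over fst_lfunE => /andP[_ /eqP v2] _ v1.
  by rewrite [v]surjective_pairing v2 v1 linear0.
by move=> v _; rewrite mem_prodv fst_lfunE => /andP[].
Qed.

Let cograph_prodv (u : coefs) p :
  (\dim (cograph (linearized u) :&: prodv (A p) (B p)) <= t)%N.
Proof.
apply: (cap_dim_le (f := snd_lfun L L) (Z := B p)); first by rewrite dimB.
- move=> v; rewrite mem_cograph snd_lfunE => /eqP v1 _ v2.
  by rewrite [v]surjective_pairing v1 v2 linear0.
by move=> v _; rewrite mem_prodv snd_lfunE => /andP[].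
Qed.

Let prodv_prodv p p' : p <> p' ->
  (\dim (prodv (A p) (B p) :&: prodv (A p') (B p')) <= t)%N.
Proof.
move=> /capAB; rewrite -dim_prodv; apply: leq_trans.
apply/dimvS/subvP=> v; rewrite memv_cap !mem_prodv !memv_cap.
by case/andP=> /andP[-> ->] /andP[-> ->].
Qed.

Lemma base_codeP : code_family base_code n t.
Proof.
split; first case=> [[u|u]|p] /=.
- by rewrite dim_graph_over.
- by rewrite dim_cograph.
- by rewrite dim_prodv dimA dimB dimL.
case=> [[u|u]|p] [[u'|u']|p'] neq /=.
- by apply: graph_graph => uu'; case: neq; rewrite uu'.
- exact/graph_cograph/(valP u').
- exact: graph_prodv.
- by rewrite capvC; apply/graph_cograph/(valP u).
- by apply: cograph_cograph => /val_inj uu'; case: neq; rewrite uu'.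
- exact: cograph_prodv.
- by rewrite capvC; apply: graph_prodv.
- by rewrite capvC; apply: cograph_prodv.
- by apply: prodv_prodv => pp'; case: neq; rewrite pp'.
Qed.

End BaseCode.

Section PairCode.

Variables (F : finFieldType) (K : fieldExtType F) (V : vectType F) (h : nat).
Local Notation n := (\dim {:K}).
Local Notation coefs := (K * {ffun 'I_h -> K})%type.
Variable iso : 'Hom((K * K)%type, V).

Hypothesis isoI : injective iso.
Hypothesis h_half : (h + h <= n)%N.

(** Some [n]-dimensional subspaces of [V]: the images under [iso] of the graphs
    of linearized polynomials and, for [None], of the subspace [0 * K]. The
    planes with the same vector [c] of higher coefficients form a class. *)
Definition plane (u : option coefs) : {vspace V} :=
  (iso @: if u is Some u' then graph_over (linearized u') fullv
          else cograph 0%R)%VS.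

Lemma dim_plane u : \dim (plane u) = n.
Proof.
have k0 : lker iso == 0%VS by apply/lker0P.
rewrite limg_dim_eq ?(eqP k0) ?capv0 //.
by case: u => [u|]; rewrite ?dim_graph_over ?dim_cograph.
Qed.

Let dim_cap_iso (X Y : {vspace (K * K)%type}) :
  \dim ((iso @: X) :&: (iso @: Y)) = \dim (X :&: Y).
Proof.
have k0 : lker iso == 0%VS by apply/lker0P.
by rewrite -lker0_img_cap // limg_dim_eq // (eqP k0) capv0.
Qed.

Lemma cap_plane_infty u : \dim (plane None :&: plane (Some u)) = 0%N.
Proof.
rewrite dim_cap_iso; apply: cap_eq0 => v; rewrite mem_cograph mem_graph_over.
rewrite zero_lfunE => /eqP v1 /andP[_ /eqP v2].
by rewrite [v]surjective_pairing v2 v1 linear0.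
Qed.

Lemma cap_plane_coset a a' c : a <> a' ->
  \dim (plane (Some (a, c)) :&: plane (Some (a', c))) = 0%N.
Proof.
move=> aa'; rewrite dim_cap_iso; apply: cap_eq0 => v; rewrite !mem_graph_over.
case/andP=> _ /eqP v2 /andP[_ /eqP v2'].
have v1 : v.1 = 0 by apply: (linearized_inj_coset (c := c) aa'); rewrite -v2.
by rewrite [v]surjective_pairing v2 v1 linear0.
Qed.

Lemma cap_plane u u' : u <> u' ->
  (\dim (plane (Some u) :&: plane (Some u')) <= h)%N.
Proof.
move=> uu'; rewrite dim_cap_iso; apply: (cap_dim_le (f := fst_lfun K K)).
- exact: dim_lker_linearizedB uu'.
- move=> v _; rewrite mem_graph_over fst_lfunE => /andP[_ /eqP v2] v1.
  by rewrite [v]surjective_pairing v2 v1 linear0.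
move=> v; rewrite !mem_graph_over fst_lfunE.
by case/andP=> _ /eqP v2 /andP[_ /eqP v2']; apply/eqlfunP; rewrite -v2.
Qed.

(** The pairs of planes: for each vector [c] of higher coefficients, the pairs
    of planes in the class of [c]; and the pairs of [plane None] with a plane
    in the class of [0]. *)
Definition pair_left (p : {ffun 'I_h -> K} * (K * K) + (K + K)) :
    option coefs :=
  match p with
  | inl (c, (a, b)) => Some (a, c)
  | inr (inl b) => None
  | inr (inr a) => Some (a, 0)
  end.

Definition pair_right (p : {ffun 'I_h -> K} * (K * K) + (K + K)) :
    option coefs :=
  match p with
  | inl (c, (a, b)) => Some (b, c)
  | inr (inl b) => Some (b, 0)
  | inr (inr a) => None
  end.

Let cap_plane_dim u u' : (\dim (plane u :&: plane u') <= n)%N.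
Proof. by rewrite -(dim_plane u); apply/dimvS/capvSl. Qed.

(** Planes of distinct classes meet in dimension at most [h], on both sides;
    those of the same class are equal or meet trivially. *)
Lemma pair_codeP p p' : p <> p' ->
  (\dim (plane (pair_left p) :&: plane (pair_left p')) +
   \dim (plane (pair_right p) :&: plane (pair_right p')) <= n)%N.
Proof.
move=> neq.
have left0 : \dim (plane (pair_left p) :&: plane (pair_left p')) = 0%N ->
    (\dim (plane (pair_left p) :&: plane (pair_left p')) +
     \dim (plane (pair_right p) :&: plane (pair_right p')) <= n)%N.
  by move->; rewrite add0n.
have right0 : \dim (plane (pair_right p) :&: plane (pair_right p')) = 0%N ->
    (\dim (plane (pair_left p) :&: plane (pair_left p')) +
     \dim (plane (pair_right p) :&: plane (pair_right p')) <= n)%N.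
  by move->; rewrite addn0.
case: p p' neq left0 right0
  => [[c [a b]]|[b|a]] [[c' [a' b']]|[b'|a']] /= neq left0 right0.
- have [cc'|/eqP cc'] := altP (c =P c'); last first.
    by apply: leq_trans h_half; apply: leq_add; apply: cap_plane => -[].
  rewrite -cc' in left0 right0 neq *.
  have [aa'|/eqP aa'] := altP (a =P a'); last exact/left0/cap_plane_coset.
  by apply/right0/cap_plane_coset => bb'; case: neq; rewrite aa' bb'.
- by apply: left0; rewrite capvC; apply: cap_plane_infty.
- by apply: right0; rewrite capvC; apply: cap_plane_infty.
- exact/left0/cap_plane_infty.
- by apply/right0/cap_plane_coset => bb'; case: neq; rewrite bb'.
- exact/left0/cap_plane_infty.
- exact/right0/cap_plane_infty.
- by apply: left0; rewrite capvC; apply: cap_plane_infty.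
- by apply/left0/cap_plane_coset => aa'; case: neq; rewrite aa'.
Qed.

End PairCode.

(** * Size of the linked code *)

Lemma gauss_binom_mul (q n t : nat) : (1 < q)%N -> (t <= n)%N ->
  gauss_binom q n t * (\prod_(i < t) (q ^ t - q ^ i))%N%:R =
  (\prod_(i < t) (q ^ n - q ^ i))%N%:R :> rat.
Proof.
move=> q_gt1 tn; have q_gt0 := ltnW q_gt1.
rewrite !natr_prod /gauss_binom -big_split /=; apply: eq_bigr => i _.
have it : (i <= t)%N := ltnW (ltn_ord i).
have split_pow r : (i <= r)%N ->
    (q ^ r - q ^ i)%N%:R = q%:R ^+ i * (q%:R ^+ (r - i) - 1) :> rat.
  move=> ir; rewrite natrB ?leq_pexp2l // !natrX mulrBr mulr1 -exprD.
  by rewrite subnKC.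
rewrite !split_pow ?(leq_trans it) //.
have nz : (q%:R ^+ (t - i) - 1 : rat) != 0.
  by rewrite subr_eq0 -natrX pnatr_eq1 -(expn0 q) eqn_exp2l // -lt0n subn_gt0.
by rewrite mulrCA divfK.
Qed.

(** In minimum rank the alternating sum is reduced to its first term. *)
Lemma rank_count_min_rank (q n t : nat) :
  rank_count q n n t t = gauss_binom q n t * (q%:R ^+ n - 1).
Proof.
rewrite /rank_count minnn maxnn subnn big_ord1 bin0n expr0 expr0 !mul1r.
by rewrite /gauss_binom big_ord0 mul1r muln1.
Qed.

Lemma rank_count_le (F : finFieldType) (L : fieldExtType F) (t : nat) :
  (t <= \dim {:L})%N ->
  rank_count #|F| (\dim {:L}) (\dim {:L}) t t <=
  #|[pred u : finvect_type L * {ffun 'I_t -> finvect_type L} |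
      \dim (lker (linearized u)) == t]|%:R.
Proof.
move=> tn; have q_gt1 : (1 < #|F|)%N := finNzRing_gt1 F.
have M_gt0 : (0 < \prod_(i < t) (#|F| ^ t - #|F| ^ i))%N.
  by rewrite prodn_gt0 // => i; rewrite subn_gt0 ltn_exp2l.
rewrite rank_count_min_rank.
rewrite -(ler_pM2r (x := (\prod_(i < t) (#|F| ^ t - #|F| ^ i))%N%:R)).
  rewrite mulrAC gauss_binom_mul //.
  have -> : #|F|%:R ^+ \dim {:L} - 1 = (#|F| ^ \dim {:L} - 1)%N%:R :> rat.
    by rewrite natrB ?expn_gt0 ?(ltnW q_gt1) // natrX.
  by rewrite -!natrM ler_nat; apply: min_rank_count.
by rewrite ltr0n.
Qed.

Section Assembly.

Variables (F : finFieldType) (L0 K0 : fieldExtType F) (k : nat).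
Local Notation L := (finvect_type L0).
Local Notation K := (finvect_type K0).
Local Notation h := k./2.
Local Notation coefs := (L * {ffun 'I_k -> L})%type.

Hypothesis k_gt0 : (0 < k)%N.
Hypothesis dimL0 : \dim {:L0} = (k + k)%N.
Hypothesis dimK0 : \dim {:K0} = k.

Let dimL : \dim {:L} = (k + k)%N := dimL0.
Let dimK : \dim {:K} = k := dimK0.

(** Coefficients of the maps of rank [k], as [L] has dimension [2 * k]. *)
Definition min_rank_coefs := {u : coefs | \dim (lker (linearized u)) == k}.
Definition higher_coefs := {c : {ffun 'I_k -> L} | c != 0}.
Definition pair_index := ({ffun 'I_h -> K} * (K * K) + (K + K))%type.

(** The codewords outside the spread: the graphs of maps that have a nonzero
    higher coefficient, the transposed graphs of the maps of rank [k], and the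
    products of planes. The spread itself is indexed by [option L]. *)
Definition nonspread := (L * higher_coefs + min_rank_coefs + pair_index)%type.

Let lker_linearized0 : lker (linearized (0%R : coefs)) = {:L}%VS.
Proof.
apply/vspaceP=> x; rewrite memvf memv_ker -(subrr (0%R : coefs)) linearizedB.
by rewrite subrr zero_lfunE eqxx.
Qed.

Let ker0 : (k <= \dim (lker (linearized (0%R : coefs))))%N.
Proof. by rewrite lker_linearized0 dimL leq_addr. Qed.

Let min_rank_le (u : min_rank_coefs) :
  (k <= \dim (lker (linearized (val u))))%N.
Proof. by rewrite (eqP (valP u)). Qed.

(** Inclusion into the index type of [base_code]. *)
Definition base_index (i : nonspread + option L) :
    coefs + {u : coefs | (k <= \dim (lker (linearized u)))%N} + pair_index :=
  match i with
  | inl (inl (inl (a, c))) => inl (inl (a, val c))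
  | inl (inl (inr u)) => inl (inr (Sub (val u) (min_rank_le u)))
  | inl (inr p) => inr p
  | inr (Some a) => inl (inl (a, 0))
  | inr None => inl (inr (Sub 0 ker0))
  end.

Lemma base_index_inj : injective base_index.
Proof.
have nz (c : higher_coefs) : val c <> 0 by apply/eqP/(valP c).
have nr (u : min_rank_coefs) : val u <> 0.
  move=> u0; have := valP u; rewrite u0 lker_linearized0 dimL.
  by rewrite -[X in _ == X]addn0 eqn_add2l eqn0Ngt k_gt0.
case=> [[[[a c]|u]|p]|[a|]] [[[[a' c']|u']|p']|[a'|]] //= [].
- by move=> -> /val_inj->.
- by move=> _ /nz.
- by move=> /val_inj->.
- by move=> /nr.
- by move=> ->.
- by move=> _ /esym/nz.
- by move=> ->.
- by move=> /esym/nr.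
Qed.

Section Code.

Variable iso : 'Hom((K * K)%type, L).
Hypothesis isoI : injective iso.

(** The code of [L * L] that contains the spread. *)
Definition spread_code (i : nonspread + option L) : {vspace (L * L)%type} :=
  base_code (fun p => plane iso (pair_left p))
            (fun p => plane iso (pair_right p)) (base_index i).

Lemma spread_codeP : code_family spread_code (k + k) k.
Proof.
apply: (code_family_comp (c := base_code _ _)) base_index_inj _.
rewrite -dimL; apply: base_codeP => // [p|p|p p' pp'].
- by rewrite dim_plane.
- by rewrite dim_plane.
rewrite -[leqRHS]dimK; apply: pair_codeP => //.
by rewrite dimK; lia.
Qed.

(** The parametrizations of the spread: [x |-> (x, a x)] and [x |-> (0, x)]. *)
Definition spread_map (s : option L) : 'Hom(L, (L * L)%type) :=
  if s is Some a then
    pair_lfun \1 (linearized (a, 0 : {ffun 'I_k -> L}))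
  else pair_lfun (linearized (0 : coefs)) \1.

Lemma limg_spread_map s : limg (spread_map s) = spread_code (inr s).
Proof. by case: s. Qed.

Lemma spread_map_eq0 s x : spread_map s x = 0 -> x = 0.
Proof. by case: s => [a|]; rewrite pair_lfunE id_lfunE => -[]. Qed.

Lemma spread_map_disjoint s s' x y :
  s <> s' -> spread_map s x = spread_map s' y -> spread_map s x = 0.
Proof.
have l0 z : linearized (0%R : coefs) z = 0.
  by apply/eqP; rewrite -memv_ker lker_linearized0 memvf.
move=> ss' E; suff -> : x = 0 by rewrite linear0.
case: s s' ss' E => [a|] [a'|] //; rewrite !pair_lfunE !id_lfunE.
- move=> aa' [-> E]; apply: (linearized_inj_coset _ E) => a_a'.
  by case: aa'; rewrite a_a'.
- by rewrite l0 => _ [].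
- by rewrite l0 => _ [<-]; rewrite linear0.
Qed.

(** The code [spread_code] with its member [0 * L] singled out. *)
Definition pointed_index (i : option (nonspread + L)) : nonspread + option L :=
  match i with
  | None => inr None
  | Some (inl j) => inl j
  | Some (inr a) => inr (Some a)
  end.

Lemma pointed_index_inj : injective pointed_index.
Proof. by case=> [[j|a]|] [[j'|a']|] //= [->]. Qed.

Lemma mem_spread_infty v : (v \in spread_code (inr None)) = (v.1 == 0).
Proof.
rewrite mem_cograph; congr (_ == _).
by apply/eqP; rewrite -memv_ker lker_linearized0 memvf.
Qed.

Lemma linked_size :
  (#|{: option (option L * (nonspread + L) + nonspread * coefs)}| <=
   max_code_size F (6 * k) (2 * k) (2 * k))%N.
Proof.
have dW j : \dim (spread_code (inl j)) = \dim {:L}.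
  by rewrite (code_family_dim spread_codeP) dimL.
pose h j := sval (inj_lfun_exists (dW j)).
have hI j : {in spread_code (inl j), forall u, h j u = 0 -> u = 0}.
  exact: (svalP (inj_lfun_exists (dW j))).
have bC := code_family_comp pointed_index_inj spread_codeP.
have lC := linked_codeP spread_codeP spread_map_eq0 limg_spread_map
  spread_map_disjoint hI (@dim_lker_linearizedB F L k) bC mem_spread_infty.
have -> : (6 * k = \dim {: ((L * L) * L)%type})%N.
  by rewrite !dim_fullv_prod dimL; lia.
rewrite mul2n -addnn; apply: (code_family_max lC); lia.
Qed.

End Code.

Lemma card_nonspread :
  (#|{: nonspread}| = #|L| * (#|L| ^ k - 1) + #|{: min_rank_coefs}| +
    (#|K| ^ (h + 2) + 2 * #|K|))%N.
Proof.
rewrite /nonspread /pair_index !card_sum !card_prod !card_ffun !card_ord.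
rewrite [#|{: higher_coefs}|]card_sig cardC1 card_ffun card_ord subn1.
by rewrite addn2 !expnSr mulnA addnn mul2n.
Qed.

End Assembly.

Theorem theorem5p7 (q : nat) (F : finFieldType) (hq : #|F| = q)
    (k : nat) (hk4 : (4 <= k)%N) (hk : ~~ odd k) :
  1 + (q%:R ^+ (2 * k) + 1) *
        (q%:R ^+ (2 * k * (k + 1)) + rank_count q (2 * k) (2 * k) k k
           + q%:R ^+ (k * (k./2 + 2)) + 2 * q%:R ^+ k)
    + (q%:R ^+ (2 * k * (k + 1)) + rank_count q (2 * k) (2 * k) k k
         + q%:R ^+ (k * (k./2 + 2)) + 2 * q%:R ^+ k - q%:R ^+ (2 * k))
      * q%:R ^+ (2 * k * (k + 1))
  <= (max_code_size F (6 * k) (2 * k) (2 * k))%:R :> rat.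
Proof.
have k_gt0 : (0 < k)%N by apply: leq_trans hk4.
have [L0 dimL0] := @fieldExt_dim_exists F (k + k) (ltn_addr k k_gt0).
have [K0 dimK0] := @fieldExt_dim_exists F k k_gt0.
set B := _ + 2 * q%:R ^+ k.
pose L := finvect_type L0; pose K := finvect_type K0.
have dimL : \dim {:L} = (k + k)%N := dimL0.
have dimK : \dim {:K} = k := dimK0.
have [iso iso0] : {f : 'Hom((K * K)%type, L) |
    {in fullv, forall x, f x = 0 -> x = 0}}.
  by apply: inj_lfun_exists; rewrite dim_fullv_prod dimK dimL.
have isoI : injective iso.
  move=> x y fxy; apply/eqP; rewrite -subr_eq0; apply/eqP/iso0.
    exact: memvf.
  by rewrite linearB /= fxy subrr.
have := linked_size k_gt0 dimL0 dimK0 isoI.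
rewrite -(ler_nat rat); apply: le_trans.
have cL : #|L| = (q ^ (2 * k))%N.
  by rewrite card_finvect_fullv dimL0 hq mul2n addnn.
have cK : #|K| = (q ^ k)%N by rewrite card_finvect_fullv dimK0 hq.
have q_gt0 : (0 < q)%N by rewrite -hq ltnW ?finNzRing_gt1.
rewrite card_option card_sum !card_prod card_sum card_option card_ffun card_ord.
set J := #|{: nonspread L0 K0 k}|; rewrite cL.
have EQ : (q ^ (2 * k) * (q ^ (2 * k)) ^ k = q ^ (2 * k * (k + 1)))%N.
  by rewrite -expnM -expnD; congr (_ ^ _)%N; lia.
(* [J] counts the codewords outside the spread, and [J + q ^ (2 * k)] all
   codewords of the first code but [0 * L]. *)
have BJ : B <= (J + q ^ (2 * k))%N%:R.
  have -> : (J + q ^ (2 * k) =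
      q ^ (2 * k * (k + 1)) + #|{: min_rank_coefs L0 k}| +
      (q ^ (k * (k./2 + 2)) + 2 * q ^ k))%N.
    rewrite /J card_nonspread cL cK -(expnM q k (k./2 + 2)) -EQ mulnBr muln1.
    have : (q ^ (2 * k) <= q ^ (2 * k) * (q ^ (2 * k)) ^ k)%N.
      by rewrite leq_pmulr ?expn_gt0 ?q_gt0.
    move: (q ^ (2 * k) * (q ^ (2 * k)) ^ k)%N => M.
    by move: (q ^ (2 * k))%N (q ^ (k * _))%N (q ^ k)%N #|_| => Q A G H; lia.
  rewrite /B 3!natrD natrM !natrX !addrA !lerD2r lerD2l.
  have := @rank_count_le F L k; rewrite dimL hq mul2n -addnn card_sig.
  by apply; apply: leq_addr.
have -> : ((((q ^ (2 * k)).+1 * (J + q ^ (2 * k)) +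
     J * (q ^ (2 * k) * (q ^ (2 * k)) ^ k)).+1)%:R = 1 +
   ((q%:R ^+ (2 * k) + 1) * (J + q ^ (2 * k))%N%:R +
   ((J + q ^ (2 * k))%N%:R - q%:R ^+ (2 * k)) * q%:R ^+ (2 * k * (k + 1)))
   :> rat).
  by rewrite EQ -!natrX; move: (q ^ _)%N (q ^ _)%N (J) => x y z; ring.
(* Both sides are the same function of [B] and [J + q ^ (2 * k)], and it is
   nondecreasing. *)
rewrite -addrA lerD2l; apply: lerD.
  by apply: ler_wpM2l BJ; rewrite addr_ge0 // exprn_ge0.
by apply: ler_wpM2r; rewrite ?exprn_ge0 // lerD2r.
Qed.
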